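(* Let $p_X$ be an input density on $\mathcal{X}$, let $x_0\in\mathcal{X}$, and let $p_{W|X}$ be a channel from $\mathcal{X}$ to $\mathcal{W}$. Let $p_W(w)=\int_{\mathcal{X}}p_X(x)p_{W|X}(w|x)\,dx$ and assume that $p_W$ is dominated by $p_{W|X=x_0}$. For an integer $n\ge 1$ and $\boldsymbol{w}=(w_1,\dots,w_n)\in\mathcal{W}^n$, $\boldsymbol{x}_0=(x_0,\dots,x_0)\in\mathcal{X}^n$, let $$p_{W^n|X^n}(\boldsymbol{w}|\boldsymbol{x}_0)=\prod_{i=1}^n p_{W|X}(w_i|x_0),\qquad p_{W^n}(\boldsymbol{w})=\prod_{i=1}^n p_W(w_i).$$ Then $$d_{\rm TV}\left(p_{W^n},\,p_{W^n|X^n=\boldsymbol{x}_0}\right)\le \frac12\sqrt{\mathsf{W}_0^{-1}\left(n\,\chi^2(p_W\parallel p_{W|X=x_0})\right)},$$ where $\mathsf{W}_0^{-1}(z)=ze^{z}$.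
   Context: $d_{\rm TV}(p,q)=\frac12\int|p(x)-q(x)|\,dx$ is the variational distance. $\chi^2(p\parallel q)=\int\frac{(p(x)-q(x))^2}{q(x)}\,dx$ is the chi-squared distance. $\mathsf{W}_0$ is the principal branch of the Lambert W function, so that $\mathsf{W}_0^{-1}(z)=ze^z$. ''$p_W$ is dominated by $p_{W|X=x_0}$'' means that $p_W(w)=0$ whenever $p_{W|X}(w|x_0)=0$. Densities may be taken with respect to Lebesgue or counting measure; input distributions may have atoms. *)

(* Defs.v *)
From HB Require Import structures.
From mathcomp Require Import all_boot all_order all_algebra.
From mathcomp Require Import all_classical all_reals all_analysis.

Set Implicit Arguments.
Unset Strict Implicit.
Unset Printing Implicit Defensive.

Import Order.TTheory GRing.Theory Num.Theory.
Import numFieldNormedType.Exports.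

Local Open Scope classical_set_scope.
Local Open Scope ring_scope.
Local Open Scope ereal_scope.

(* Densities are taken with respect to an arbitrary sigma-finite reference
   measure: Lebesgue measure, counting measure on a countable alphabet, and
   mixtures of them (input distributions with atoms) are all instances. *)
Definition is_density d (T : measurableType d) (R : realType)
    (mu : set T -> \bar R) (p : T -> R) : Prop :=
  [/\ measurable_fun setT p, (forall x, (0 <= p x)%R)
    & \int[mu]_x (p x)%:E = 1].

(* [p x w] is the conditional density at [w] given the input [x]. *)
Definition is_channel_density d1 d2 (X : measurableType d1)
    (W : measurableType d2) (R : realType)
    (muW : set W -> \bar R) (p : X -> W -> R) : Prop :=
  measurable_fun setT (fun xw : X * W => p xw.1 xw.2) /\
  forall x, is_density muW (p x).

(* The output density is extended-real valued: the defining integral may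
   diverge, a priori, at some points of [W]. *)
Definition output_density d1 (X : measurableType d1) (W : Type) (R : realType)
    (muX : set X -> \bar R) (pX : X -> R) (pWX : X -> W -> R) (w : W) : \bar R :=
  \int[muX]_x (pX x * pWX x w)%:E.

Definition dominated_density (T : Type) (R : realType) (p q : T -> \bar R) :
  Prop := forall w, q w = 0 -> p w = 0.

Definition dTV d (T : measurableType d) (R : realType)
    (mu : set T -> \bar R) (p q : T -> \bar R) : \bar R :=
  (2^-1)%:E * \int[mu]_x `|p x - q x|.

(* Division is that of [\bar R], where [r / 0 = +oo] for [0 < r] and
   [0 / 0 = 0]: the integrand is [+oo] wherever [q] vanishes but [p] does not. *)
Definition chi2 d (T : measurableType d) (R : realType)
    (mu : set T -> \bar R) (p q : T -> \bar R) : \bar R :=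
  \int[mu]_x ((p x - q x) ^+ 2 / q x).

(* The inverse of the principal branch of the Lambert W function, extended by
   [+oo |-> +oo]. *)
Definition lambertW0_inv (R : realType) (z : \bar R) : \bar R := z * expeR z.

Definition density_power (T : Type) (R : realType) (n : nat) (p : T -> \bar R)
    (w : n.-tuple T) : \bar R :=
  \prod_(i < n) p (tnth w i).

(* The n-fold product of [mu], as a measure on the n-tuples. *)
Section measure_power.
Context d (T : measurableType d) (R : realType).
Variable mu : {sigma_finite_measure set T -> \bar R}.

Fixpoint measure_power (n : nat) : set (n.-tuple T) -> \bar R :=
  match n with
  | 0 => \d_ [tuple]
  | m.+1 => pushforward (mu \x @measure_power m)
              (fun u : T * m.-tuple T => [tuple of u.1 :: u.2])
  end.
Arguments measure_power : clear implicits.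

Let cons_t m (u : T * m.-tuple T) : m.+1.-tuple T := [tuple of u.1 :: u.2].

Let uncons_t m (t : m.+1.-tuple T) : T * m.-tuple T :=
  (thead t, [tuple of behead t]).

Let cons_tK m : cancel (@cons_t m) (@uncons_t m).
Proof. by case=> x t; congr pair; apply: val_inj. Qed.

Let uncons_tK m : cancel (@uncons_t m) (@cons_t m).
Proof. by move=> t; rewrite [RHS]tuple_eta; apply: val_inj. Qed.

Let measurable_cons_t m : measurable_fun setT (@cons_t m).
Proof. exact: measurable_cons. Qed.

Let measurable_uncons_t m : measurable_fun setT (@uncons_t m).
Proof.
by apply: measurable_fun_pair; [exact: measurable_tnth|exact: measurable_behead].
Qed.

Let measure_power_ex n :
  exists nu : {sigma_finite_measure set (n.-tuple T) -> \bar R},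
    measure_power n = nu.
Proof.
elim: n => [|m [nu IH]].
  by exists (\d_ [tuple] : {sigma_finite_measure set (0.-tuple T) -> \bar R}).
pose k' := (pushforward (mu \x nu) (@cons_t m)
  : {measure set (m.+1.-tuple T) -> \bar R}).
pose k := k' (@measurable_cons_t m).
have sk : sigma_finite setT k.
  have /sigma_finiteP[F [FT ndF Foo]] := sigma_finiteT mu.
  have /sigma_finiteP[G [GT ndG Goo]] := sigma_finiteT nu.
  exists (fun i => @uncons_t m @^-1` (F i `*` G i)) => [|i].
    rewrite -preimage_bigcup; apply/esym; rewrite -subTset => t _ /=.
    have [i _ Fi] : (\bigcup_i F i) (uncons_t t).1 by rewrite -FT.
    have [j _ Gj] : (\bigcup_i G i) (uncons_t t).2 by rewrite -GT.
    exists (maxn i j) => //; split.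
      by move: Fi; exact/subsetPset/ndF/leq_maxl.
    by move: Gj; exact/subsetPset/ndG/leq_maxr.
  have [mF Fi] := Foo i; have [mG Gi] := Goo i; split.
    rewrite -[X in measurable X]setTI.
    by apply: measurable_uncons_t => //; exact: measurableX.
  rewrite /k /k' /= /pushforward -comp_preimage.
  rewrite (_ : _ \o _ = id); last by apply/funext => u /=; exact: cons_tK.
  by rewrite preimage_id product_measure1E// lte_mul_pinfty// ge0_fin_numE.
pose ks := Measure_isSigmaFinite.Build _ _ _ k sk.
pose K : {sigma_finite_measure set (m.+1.-tuple T) -> \bar R} :=
  HB.pack (k : set (m.+1.-tuple T) -> \bar R) (Measure.on k) ks.
by exists K; rewrite /= IH.
Qed.

Variable n : nat.

Let measure_power0 : measure_power n set0 = 0.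
Proof. by have [nu ->] := measure_power_ex n; rewrite measure0. Qed.

Let measure_power_ge0 A : 0 <= measure_power n A.
Proof. by have [nu ->] := measure_power_ex n; exact: measure_ge0. Qed.

Let measure_power_sigma_additive : semi_sigma_additive (measure_power n).
Proof.
by have [nu ->] := measure_power_ex n; exact: measure_semi_sigma_additive.
Qed.

HB.instance Definition _ := isMeasure.Build _ _ _ (measure_power n)
  measure_power0 measure_power_ge0 measure_power_sigma_additive.

Let measure_power_sigma_finite : sigma_finite setT (measure_power n).
Proof. by have [nu ->] := measure_power_ex n; exact: sigma_finiteT. Qed.

HB.instance Definition _ := Measure_isSigmaFinite.Build _ _ _ (measure_power n)
  measure_power_sigma_finite.

End measure_power.
Arguments measure_power {d T R} mu n.

Lemma measure_power_box d (T : measurableType d) (R : realType)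
    (mu : {sigma_finite_measure set T -> \bar R}) (n : nat)
    (A : 'I_n -> set T) : (forall i, measurable (A i)) ->
  measure_power mu n [set t : n.-tuple T | forall i, A i (tnth t i)] =
  \prod_(i < n) mu (A i).
Proof.
elim: n A => [|n IH] A mA.
  by rewrite big_ord0 /= diracE mem_set// => -[].
rewrite big_ord_recl -(IH (fun i => A (lift ord0 i)))// /= /pushforward.
rewrite -product_measure1E//; last first.
  rewrite (_ : [set _ | _] = \bigcap_(i in [set: 'I_n])
      ((fun t => tnth t i) @^-1` A (lift ord0 i))).
    apply: fin_bigcap_measurable => // i _.
    by rewrite -[X in measurable X]setTI; exact: measurable_tnth.
  by apply/seteqP; split => t /= tA i => [_|]; exact: tA.
congr (_ _); apply/seteqP; split => -[x t] /=.
  move=> xtA; split; first by have := xtA ord0; rewrite tnth0.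
  by move=> i; have := xtA (lift ord0 i); rewrite tnthS.
move=> [xA tA] i; have [->|/eqP] := eqVneq i ord0; first by rewrite tnth0.
by case: (unliftP ord0 i) => [j ->|->]// _; rewrite tnthS.
Qed.

(* Main.v *)
(** Write [P] and [Q] for the two product densities. By AM-GM, for all [s > 0],
    [2 |P - Q| <= s (P - Q)^2 / Q + Q / s]. Since all densities have mass 1,
    integrating gives [2 \int |P - Q| <= s (\int P^2 / Q - 1) + 1 / s], where
    [\int P^2 / Q = (1 + c)^n] with [c] the single-letter chi-squared distance,
    and [(1 + c)^n - 1 <= exp(n c) - 1 <= n c exp(n c)]. Optimizing over [s]
    yields the square root. *)

Require Import Defs.
From mathcomp Require Import all_boot all_order all_algebra.
From mathcomp Require Import all_classical all_reals all_analysis.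
From mathcomp Require Import measurable_realfun ring lra.

Set Implicit Arguments.
Unset Strict Implicit.
Unset Printing Implicit Defensive.

Import Order.TTheory GRing.Theory Num.Theory.
Import numFieldNormedType.Exports.

Local Open Scope classical_set_scope.
Local Open Scope ring_scope.
Local Open Scope ereal_scope.

(** * Measurability and integrals of product densities *)

Lemma emeasurable_fun_prod d (T : measurableType d) (R : realType)
    (I : Type) (s : seq I) (f : I -> T -> \bar R) :
  (forall i, measurable_fun setT (f i)) ->
  measurable_fun setT (fun x => \prod_(i <- s) f i x).
Proof.
move=> mf; elim: s => [|i s IH].
  by under eq_fun do rewrite big_nil; exact: measurable_cst.
by under eq_fun do rewrite big_cons; exact: emeasurable_funM.
Qed.

(** On nonnegative reals the inverse is the power with exponent [-1], also at [0], where both are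
    [0]. *)
Lemma measurable_fun_inv d (T : measurableType d) (R : realType) (f : T -> R) :
  measurable_fun setT f -> (forall x, 0 <= f x)%R ->
  measurable_fun setT (fun x => (f x)^-1)%R.
Proof.
move=> mf f0.
under eq_fun do rewrite -powR_inv1//.
exact: (measurableT_comp (@measurable_powR R (-1)%R) mf).
Qed.

Lemma measurable_density_power d (T : measurableType d) (R : realType) n
    (f : T -> \bar R) :
  measurable_fun setT f -> measurable_fun setT (@density_power T R n f).
Proof.
move=> mf; apply: emeasurable_fun_prod => i.
exact: measurableT_comp (measurable_tnth i).
Qed.

Lemma density_power_ge0 (T : Type) (R : realType) n (f : T -> \bar R)
    (t : n.-tuple T) : (forall x, 0 <= f x) -> 0 <= density_power f t.
Proof. by move=> f0; exact: prode_ge0. Qed.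

(** Induction on [n]: the measure on the longer tuples is the image of a product measure under cons,
    so a change of variables and Tonelli split off one factor. Nonnegativity alone suffices, so
    infinite integrals are covered. *)
Lemma integral_density_power d (T : measurableType d) (R : realType)
    (mu : {sigma_finite_measure set T -> \bar R}) n (f : T -> \bar R) :
  measurable_fun setT f -> (forall x, 0 <= f x) ->
  \int[measure_power mu n]_t density_power f t = (\int[mu]_x f x) ^+ n.
Proof.
move=> mf f0; elim: n => [|n IH].
  rewrite integral_dirac//; last exact: measurable_density_power.
  by rewrite diracT mul1e /density_power big_ord0.
rewrite expeS.
have consE (u : T * n.-tuple T) :
    density_power f [tuple of u.1 :: u.2] = f u.1 * density_power f u.2.
  rewrite /density_power big_ord_recl tnth0; congr (_ * _).
  by apply: eq_bigr => i _; rewrite tnthS.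
have inner x :
    \int[measure_power mu n]_t (f x * density_power f t) =
    f x * (\int[mu]_x f x) ^+ n.
  rewrite ge0_integralZl ?IH//; first exact: measurable_density_power.
  by move=> t _; exact: density_power_ge0.
rewrite [measure_power mu n.+1]/(pushforward (mu \x measure_power mu n)
  (fun u : T * n.-tuple T => [tuple of u.1 :: u.2])).
rewrite ge0_integral_pushforward//.
- rewrite preimage_setT.
  under eq_integral do rewrite /= consE.
  rewrite fubini_tonelli1//.
  + rewrite /fubini_F/=.
    under eq_integral do rewrite inner.
    rewrite ge0_integralZr//.
    by rewrite expe_ge0// integral_ge0.
  + apply: emeasurable_funM; first exact: measurableT_comp.
    by apply: measurableT_comp => //; exact: measurable_density_power.
  + by move=> u; rewrite mule_ge0//; exact: density_power_ge0.
- exact: measurable_cons.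
- exact: measurable_density_power.
- by move=> t _; exact: density_power_ge0.
Qed.

(** * Pointwise and real inequalities *)

(* [2 |g - h| <= s (g - h)^2 / h + h / s] with the terms rearranged so that all
   of them are nonnegative: it then holds for [g = +oo] and can be integrated
   term by term without integrability conditions. *)
Lemma abs_sub_le_sqr_div (R : realType) (g : \bar R) (h s : R) :
  0 <= g -> (0 <= h)%R -> (0 < s)%R -> (h = 0%R -> g = 0) ->
  2%:E * `|g - h%:E| + (2 * s)%:E * g <=
  s%:E * (g * g * (h^-1)%:E) + (s + s^-1)%:E * h%:E.
Proof.
move=> g0 h0 s0 hg; have [h_eq0|hn0] := eqVneq h 0%R.
  by rewrite hg// h_eq0 sube0 abse0 !mule0 !mul0e !mule0.
have {h0 hg hn0} h0 : (0 < h)%R by rewrite lt_neqAle eq_sym hn0.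
case: g g0 => [g g0| _ |//]; last first.
  rewrite [X in _ <= X](_ : _ = +oo) ?leey// mulyy gt0_mulye ?lte_fin ?invr_gt0//.
  by rewrite gt0_muley ?lte_fin// addye.
rewrite -!EFinM -!EFinD lee_fin -subr_ge0.
(* Completing the square: the difference of the two sides is
   [s (g - h)^2 / h - 2 |g - h| + h / s]. *)
rewrite (_ : (_ - _)%R = (h / s * (s * `|g - h| / h - 1) ^+ 2)%R).
  by rewrite mulr_ge0 ?sqr_ge0// divr_ge0// ltW.
have u2 : (`|g - h| ^+ 2 = (g - h) ^+ 2)%R by rewrite real_normK ?num_real.
have -> : (h / s * (s * `|g - h| / h - 1) ^+ 2 =
    s * `|g - h| ^+ 2 / h - 2 * `|g - h| + h / s)%R.
  by field; rewrite !gt_eqF.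
by rewrite u2; field; rewrite !gt_eqF.
Qed.

(** This is the expanded square, with the cross term moved to the left so that no infinite value is
    subtracted when [p = +oo]. *)
Lemma chi2_expand (R : realType) (p : \bar R) (q : R) :
  0 <= p -> (0 <= q)%R -> (q = 0%R -> p = 0) ->
  (p - q%:E) ^+ 2 / q%:E + 2%:E * p = p * p * (q^-1)%:E + q%:E.
Proof.
move=> p0 q0 qp; have [q_eq0|qn0] := eqVneq q 0%R.
  by rewrite qp// q_eq0 sube0 expe2 !mul0e mule0.
have {q0 qp} q0 : (0 < q)%R by rewrite lt_neqAle eq_sym qn0.
rewrite inver (negbTE qn0); case: p p0 => [p p0| _ |//].
  by rewrite -EFinB expe2 -!EFinM -!EFinD; congr EFin; field.
by rewrite addye// expe2 mulyy gt0_mulye ?lte_fin ?invr_gt0// gt0_muley ?lte_fin.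
Qed.

(** Makes [P^2 / Q] a product density, so that its integral is the [n]-th power of a single-letter
    integral. *)
Lemma density_power_sqr_div (T : Type) (R : realType) n (p : T -> \bar R)
    (q : T -> R) (t : n.-tuple T) :
  density_power (fun w => p w * p w * ((q w)^-1)%:E) t =
  density_power p t * density_power p t *
    ((\prod_(i < n) q (tnth t i))^-1)%:E.
Proof. by rewrite /density_power !big_split/= prodEFin prodfV. Qed.

Lemma exprn_sub1_le (R : realType) (c : R) n : (0 <= c)%R ->
  ((1 + c) ^+ n - 1 <= n%:R * c * expR (n%:R * c))%R.
Proof.
move=> c0.
have le1 : ((1 + c) ^+ n <= expR (n%:R * c))%R.
  rewrite mulrC expRM_natr.
  by apply: lerXn2r; rewrite ?nnegrE ?expR_ge0 ?expR_ge1Dx// addr_ge0.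
apply: (le_trans (lerB le1 (lexx 1%R))).
set z := (n%:R * c)%R.
(* Multiplying [1 - z <= exp(- z)] by [exp z] gives [exp z - 1 <= z exp z]. *)
have := expR_ge1Dx (- z)%R.
rewrite -(ler_pM2r (expR_gt0 z)) -expRD addNr expR0; lra.
Qed.

Lemma le_sqrt_amgm (R : realType) (A D : R) : (0 <= D)%R -> (0 <= A)%R ->
  (forall s, 0 < s -> 2 * A <= s * D + s^-1)%R -> (A <= Num.sqrt D)%R.
Proof.
move=> D0 A0 H; have [->|An0] := eqVneq A 0%R; first exact: sqrtr_ge0.
have Agt0 : (0 < A)%R by rewrite lt_neqAle eq_sym An0.
rewrite -(@ger0_norm _ A)// -sqrtr_sqr ler_wsqrtr//.
(* The choice [s = 1 / A] gives [2 A <= D / A + A], that is [A^2 <= D], even when [D = 0]. *)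
have := H A^-1%R; rewrite invr_gt0 invrK => /(_ Agt0).
rewrite -(ler_pM2l Agt0) mulrDr mulVKf//; lra.
Qed.

(** * The bound for a density [p] dominated by [q] *)

Section product_densities.
Context d (W : measurableType d) (R : realType).
Variables (mu : {sigma_finite_measure set W -> \bar R}).
Variables (p : W -> \bar R) (q : W -> R) (n : nat).
Hypotheses (mp : measurable_fun setT p) (p0 : forall w, 0 <= p w).
Hypotheses (p1 : \int[mu]_w p w = 1) (dq : is_density mu q).
Hypothesis pq : dominated_density p (EFin \o q).

(* The real inverse, which is [0] at [0], agrees with the division of [\bar R]
   here because [p] vanishes wherever [q] does. *)
Let r w := p w * p w * ((q w)^-1)%:E.

Let mq : measurable_fun setT q. Proof. by case: dq. Qed.
Let q0 w : (0 <= q w)%R. Proof. by case: dq. Qed.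
Let q1 : \int[mu]_w (q w)%:E = 1. Proof. by case: dq. Qed.
Let mEq : measurable_fun setT (EFin \o q). Proof. exact/measurable_EFinP. Qed.

Let mr : measurable_fun setT r.
Proof.
apply: emeasurable_funM; first exact: emeasurable_funM.
by apply/measurable_EFinP; exact: measurable_fun_inv.
Qed.

Let r0 w : 0 <= r w.
Proof. by rewrite /r !mule_ge0// lee_fin invr_ge0. Qed.

Let qp w : q w = 0%R -> p w = 0.
Proof. by move=> qw; apply: pq; rewrite /= qw. Qed.

Let integrand w := (p w - (q w)%:E) ^+ 2 / (q w)%:E.

Let integrand_ge0 w : 0 <= integrand w.
Proof.
have [qw|qw] := eqVneq (q w) 0%R.
  by rewrite /integrand (qp qw) qw sube0 expe2 mul0e mul0e.
rewrite /integrand mule_ge0//; first exact: sqre_ge0.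
by rewrite inve_ge0 lee_fin.
Qed.

Lemma integral_sqr_div (c : R) : chi2 mu p (EFin \o q) = c%:E ->
  \int[mu]_w (p w * p w * ((q w)^-1)%:E) = (1 + c)%:E.
Proof.
move=> chi2c.
have mi : measurable_fun setT integrand.
  (* Where [q] vanishes the numerator is [0], so either convention for the inverse of [0] gives
     [0]. *)
  have -> : integrand = (fun w => (p w - (q w)%:E) ^+ 2 * ((q w)^-1)%:E).
    apply/funext => w; rewrite /integrand inver; case: eqVneq => // qw.
    by rewrite (qp qw) qw sube0 expe2 !mul0e.
  apply: emeasurable_funM; last first.
    by apply/measurable_EFinP; exact: measurable_fun_inv.
  under eq_fun do rewrite expe2.
  by apply: emeasurable_funM; exact: emeasurable_funB.
have : \int[mu]_w (integrand w + 2%:E * p w) = \int[mu]_w (r w + (q w)%:E).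
  by apply: eq_integral => w _; rewrite /integrand chi2_expand//; exact: qp.
rewrite !ge0_integralD//.
- rewrite ge0_integralZl_EFin// p1 q1 mule1.
  rewrite (_ : \int[mu]_w integrand w = c%:E)//.
  (* The integrated identity reads [c + 2 = \int r + 1], which also rules out an infinite
     [\int r]. *)
  case: (\int[mu]_w r w) => [m|//|//].
  by rewrite -!EFinD => -[] E; congr EFin; lra.
- by move=> w _; rewrite lee_fin.
- by move=> w _; rewrite mule_ge0.
- exact: measurable_funeM.
Qed.

Let P := @density_power W R n p.
Let Q := @density_power W R n (EFin \o q).

(** Integrates [abs_sub_le_sqr_div] at [g = P t], [h = Q t]; the terms [2 * s] and [s + s^-1] are
    the coefficients of [\int P = 1] and [\int Q = 1]. *)
Lemma integral_abs_sub_le (c s : R) :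
  chi2 mu p (EFin \o q) = c%:E -> (0 < s)%R ->
  2%:E * \int[measure_power mu n]_t `|P t - Q t| + (2 * s)%:E <=
  (s * (1 + c) ^+ n + (s + s^-1))%:E.
Proof.
move=> chi2c s0.
have mP : measurable_fun setT P by exact: measurable_density_power.
have mQ : measurable_fun setT Q by exact: measurable_density_power.
have mPQ : measurable_fun setT (fun t => `|P t - Q t|).
  by apply: measurableT_comp => //; exact: emeasurable_funB.
have P0 t : 0 <= P t by exact: density_power_ge0.
have Q0 t : 0 <= Q t by apply: density_power_ge0 => w; rewrite lee_fin.
have mrn : measurable_fun setT (@density_power W R n r).
  exact: measurable_density_power.
have rn0 (t : n.-tuple W) : 0 <= density_power r t by exact: density_power_ge0.
have expe1n : (1 : \bar R) ^+ n = 1 by rewrite -EFin_expe expr1n.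
have IP : \int[measure_power mu n]_t P t = 1.
  by rewrite integral_density_power// p1 expe1n.
have IQ : \int[measure_power mu n]_t Q t = 1.
  by rewrite integral_density_power//= ?q1 ?expe1n// => w; rewrite lee_fin.
have Ir : \int[measure_power mu n]_t density_power r t = ((1 + c) ^+ n)%:E.
  by rewrite integral_density_power// (integral_sqr_div chi2c) EFin_expe.
have ss0 : (0 <= s + s^-1)%R by rewrite addr_ge0// ?invr_ge0 ltW.
pose lhs t := 2%:E * `|P t - Q t| + (2 * s)%:E * P t.
pose rhs t := s%:E * density_power r t + (s + s^-1)%:E * Q t.
have s20 : (0 <= 2 * s)%R by rewrite mulr_ge0// ltW.
have lhsE : \int[measure_power mu n]_t lhs t =
    2%:E * \int[measure_power mu n]_t `|P t - Q t| + (2 * s)%:E.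
  rewrite ge0_integralD//; last 3 first.
  - exact: measurable_funeM.
  - by move=> t _; rewrite mule_ge0.
  - exact: measurable_funeM.
  by rewrite !ge0_integralZl_EFin// IP mule1.
have rhsE : \int[measure_power mu n]_t rhs t =
    (s * (1 + c) ^+ n + (s + s^-1))%:E.
  rewrite ge0_integralD//; last 4 first.
  - by move=> t _; rewrite mule_ge0// lee_fin ltW.
  - exact: measurable_funeM.
  - by move=> t _; rewrite mule_ge0.
  - exact: measurable_funeM.
  rewrite !ge0_integralZl_EFin//; last exact: ltW.
  by rewrite IQ Ir mule1.
rewrite -lhsE -rhsE; apply: ge0_le_integral => //.
- by move=> t _; rewrite adde_ge0// mule_ge0.
- by apply: emeasurable_funD; exact: measurable_funeM.
- by apply: emeasurable_funD; exact: measurable_funeM.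
move=> t _; rewrite /lhs /rhs density_power_sqr_div.
have -> : Q t = (\prod_(i < n) q (tnth t i))%:E.
  by rewrite /Q /density_power/= prodEFin.
apply: abs_sub_le_sqr_div => //; first exact: prodr_ge0.
(* Domination passes to products: if [Q t = 0], some factor of [Q t] is [0], and so is the
   corresponding factor of [P t]. *)
move=> /eqP; rewrite prodf_seq_eq0 => /hasP[i _ /= /eqP qi0].
by rewrite /P /density_power (bigD1 i)//= (qp qi0) mul0e.
Qed.

Lemma dTV_density_power_le : (0 < n)%N ->
  dTV (measure_power mu n) P Q <=
  (2^-1)%:E * sqrte (lambertW0_inv (n%:R%:E * chi2 mu p (EFin \o q))).
Proof.
move=> n0; rewrite /dTV lee_pmul2l//.
have : 0 <= chi2 mu p (EFin \o q) by apply: integral_ge0 => w _; exact: integrand_ge0.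
case E : (chi2 _ _ _) => [c| |//] c0; last first.
  (* For an infinite chi-squared distance the bound is [+oo]; [0 < n] excludes the product
     [0 * +oo = 0]. *)
  by rewrite gt0_muley ?lte_fin ?ltr0n// /lambertW0_inv/= leey.
rewrite lee_fin in c0.
have := @integral_abs_sub_le c _ E; set A := \int[_]_t _ => A_le.
have : 0 <= A by exact: integral_ge0.
case: A A_le => [a| |//] A_le a0; last first.
  (* The case [s = 1] already shows that [\int |P - Q|] is finite. *)
  by have := A_le _ ltr01; rewrite gt0_muley ?lte_fin.
rewrite /lambertW0_inv -EFinM /= lee_fin; apply: le_sqrt_amgm => //.
  by rewrite !mulr_ge0 ?expR_ge0.
move=> s s0; have := A_le s s0; rewrite -EFinM -EFinD lee_fin => H.
have := ler_wpM2l (ltW s0) (exprn_sub1_le n c0); lra.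
Qed.

End product_densities.

(** * The output density of a channel is a density *)

Section output_density.
Context dX (X : measurableType dX) dW (W : measurableType dW) (R : realType).
Variables (muX : {sigma_finite_measure set X -> \bar R}).
Variables (muW : {sigma_finite_measure set W -> \bar R}).
Variables (pX : X -> R) (pWX : X -> W -> R).
Hypotheses (hpX : is_density muX pX) (hpWX : is_channel_density muW pWX).

Let joint (xw : X * W) := (pX xw.1 * pWX xw.1 xw.2)%:E.

Let mjoint : measurable_fun setT joint.
Proof.
case: hpX => mpX _ _; case: hpWX => mpWX _.
by apply/measurable_EFinP; apply: measurable_funM => //; exact: measurableT_comp.
Qed.

Let joint_ge0 xw : 0 <= joint xw.
Proof.
case: hpX => _ pX0 _; case: hpWX => _ /(_ xw.1)[_ pWX0 _].
by rewrite lee_fin mulr_ge0.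
Qed.

Lemma output_density_ge0 w : 0 <= output_density muX pX pWX w.
Proof. by apply: integral_ge0 => x _; exact: (joint_ge0 (x, w)). Qed.

Lemma measurable_output_density :
  measurable_fun setT (output_density muX pX pWX).
Proof. exact: (measurable_fun_fubini_tonelli_G _ mjoint). Qed.

(** By Tonelli the output letter can be integrated first; each conditional density has mass 1, which
    leaves the mass of [pX]. *)
Lemma integral_output_density :
  \int[muW]_w output_density muX pX pWX w = 1.
Proof.
rewrite /output_density -(fubini_tonelli _ mjoint joint_ge0).
case: hpX => mpX pX0 pX1; rewrite -[RHS]pX1; apply: eq_integral => x _.
case: hpWX => _ /(_ x)[mpWX pWX0 pWX1]; rewrite /joint/=.
under eq_integral do rewrite EFinM.
rewrite ge0_integralZl_EFin ?pWX1 ?mule1//.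
- by move=> w _; rewrite lee_fin.
- exact/measurable_EFinP.
Qed.

End output_density.

Theorem lemma1 (R : realType)
    (dX : measure_display) (X : measurableType dX)
    (dW : measure_display) (W : measurableType dW)
    (muX : {sigma_finite_measure set X -> \bar R})
    (muW : {sigma_finite_measure set W -> \bar R})
    (pX : X -> R) (x0 : X) (pWX : X -> W -> R) (n : nat)
    (hpX : is_density muX pX)
    (hpWX : is_channel_density muW pWX)
    (hdom : dominated_density (output_density muX pX pWX) (EFin \o pWX x0))
    (hn : (0 < n)%N) :
  dTV (measure_power muW n)
      (density_power (output_density muX pX pWX))
      (density_power (EFin \o pWX x0))
  <= (2^-1)%:E *
     sqrte (lambertW0_inv
       (n%:R%:E * chi2 muW (output_density muX pX pWX) (EFin \o pWX x0))).
Proof.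
apply: dTV_density_power_le => //.
- exact: (measurable_output_density hpX hpWX).
- exact: (output_density_ge0 hpX hpWX).
- exact: (integral_output_density hpX hpWX).
- by case: hpWX => _ /(_ x0).
Qed.
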